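(* Let $n,k$ be positive integers with $k\mid n$, put $N:=\{1,\ldots,n\}$, $P_{nk}:=\{X\subseteq N\mid k\text{ divides }|X|\}$, $X':=N\setminus X$ for $X\in P_{nk}$, and $\mathbf P_{nk}:=(P_{nk},\subseteq,{}',\emptyset,N)$. Let $A,B,C\in P_{nk}$. Then (i) $\mathbf P_{nk}$ is an orthomodular poset; (ii) $A\perp B$ if and only if $A\cap B=\emptyset$; (iii) $A\leftrightarrow B$ if and only if $A\cap B\in P_{nk}$; (iv) $\mathbf P_{nk}$ is an orthomodular lattice if and only if $k=1$ (then it is a Boolean algebra) or $n/k\leq2$; (v) if $|A\cap B|<k$ then $UL(A,B)=P_{nk}$; (vi) if $|A\cap B|\geq k$ then $C\in UL(A,B)$ if and only if $C\supseteq A\cap B$; (vii) if $|A\cap B|\geq k$ and $|A\cap B'|\geq k$ then $A\mathrel\Delta B$; (viii) if $|A\cap B|,|A\cap B'|,|A'\cap B|,|A'\cap B'|\geq k$ then $d(A,B)=\{N\}$; (ix) if $n\geq4k$ and $k>1$ then there exist $D,E\in P_{nk}$ such that $D\mathrel\Delta E$ holds and $E\mathrel\Delta D$ does not hold; (x) if $n\geq6k$ and $k>1$ then there exist $D,E\in P_{nk}$ such that $D\leftrightarrow E$ does not hold and $d(D,E)=\{N\}$; (xi) if $|A|=k$ then $A\mathrel\Delta B$ if and only if $A\leftrightarrow B$.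
   Context: An orthoposet is a tuple $(P,\leq,{}',0,1)$ where $(P,\leq,0,1)$ is a bounded poset and ${}'$ is a unary operation on $P$ such that $x\leq y$ implies $y'\leq x'$, $x''=x$, and for every $x$ the supremum $x\vee x'$ exists and equals $1$ and the infimum $x\wedge x'$ exists and equals $0$. Elements $x,y$ are orthogonal, $x\perp y$, if $x\leq y'$. An orthogonal poset is an orthoposet in which the supremum $x\vee y$ exists whenever $x\perp y$. An orthomodular poset is an orthogonal poset in which $x\leq y$ implies $x\vee(x\vee y')'=y$; an orthomodular lattice is an orthomodular poset that is a lattice. For $A\subseteq P$ let $L(A)$ and $U(A)$ be the sets of all lower bounds and of all upper bounds of $A$ in $P$; several arguments (elements or subsets) denote the bounds of the union, e.g. $L(a,b)=L(\{a,b\})$, $U(A,B)=U(A\cup B)$, and $UL(a,b)=U(L(a,b))$. For $a,b\in P$: $a\mathrel\Delta b$ means $U(a)=U(L(a,b),L(a,b'))$; $a\leftrightarrow b$ means that there exist $c,d,e\in P$ with $c\perp d\perp e\perp c$, $a=c\vee d$ and $b=d\vee e$; $d(a,b):=U(L(a,b),L(a,b'),L(a',b),L(a',b'))$. In the claim all these notions are taken in $\mathbf P_{nk}$, ordered by inclusion; elements $A,B,\ldots$ of $P_{nk}$ play the role of single elements of the poset, so $L(A,B)$ is the set of $X\in P_{nk}$ with $X\subseteq A$ and $X\subseteq B$. *)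

(* Defs.v *)
From HB Require Import structures.
From mathcomp Require Import all_boot all_order.
From mathcomp Require Import boolp classical_sets.

Set Implicit Arguments.
Unset Strict Implicit.
Unset Printing Implicit Defensive.

Import Order.TTheory.

Local Open Scope classical_set_scope.
Local Open Scope order_scope.

(* Suprema and infima are relations, since they are partial in a poset:
   [is_join x y s] says that x \/ y exists and equals s. The sets of lower and
   upper bounds L(A) and U(A) are the library's [lbound A] and [ubound A]. *)
Definition is_join (d : Order.disp_t) (T : porderType d) (x y s : T) : Prop :=
  supremums [set x; y] s.

Definition is_meet (d : Order.disp_t) (T : porderType d) (x y i : T) : Prop :=
  infimums [set x; y] i.

Definition is_bounded (d : Order.disp_t) (T : porderType d) (z u : T) : Prop :=
  forall x : T, z <= x <= u.

Definition is_lattice (d : Order.disp_t) (T : porderType d) : Prop :=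
  forall x y : T, (exists s, is_join x y s) /\ (exists i, is_meet x y i).

Definition is_orthoposet (d : Order.disp_t) (T : porderType d)
    (cpl : T -> T) (z u : T) : Prop :=
  [/\ is_bounded z u,
      {homo cpl : x y /~ x <= y},
      involutive cpl,
      forall x, is_join x (cpl x) u &
      forall x, is_meet x (cpl x) z].

Definition orth (d : Order.disp_t) (T : porderType d)
    (cpl : T -> T) (x y : T) : Prop :=
  x <= cpl y.

Definition is_orthogonal_poset (d : Order.disp_t) (T : porderType d)
    (cpl : T -> T) (z u : T) : Prop :=
  is_orthoposet cpl z u /\
  forall x y, orth cpl x y -> exists s, is_join x y s.

(* In the orthomodular law, [s] is the supremum of x and y'. *)
Definition is_orthomodular_poset (d : Order.disp_t) (T : porderType d)
    (cpl : T -> T) (z u : T) : Prop :=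
  is_orthogonal_poset cpl z u /\
  forall x y, x <= y ->
    exists s, is_join x (cpl y) s /\ is_join x (cpl s) y.

Definition is_orthomodular_lattice (d : Order.disp_t) (T : porderType d)
    (cpl : T -> T) (z u : T) : Prop :=
  is_orthomodular_poset cpl z u /\ is_lattice T.

Definition is_boolean_algebra (d : Order.disp_t) (T : porderType d)
    (cpl : T -> T) (z u : T) : Prop :=
  is_bounded z u /\
  exists join meet : T -> T -> T,
    [/\ forall x y, is_join x y (join x y),
        forall x y, is_meet x y (meet x y),
        left_distributive meet join,
        forall x, join x (cpl x) = u &
        forall x, meet x (cpl x) = z].

(* a Delta b *)
Definition Delta (d : Order.disp_t) (T : porderType d)
    (cpl : T -> T) (a b : T) : Prop :=
  ubound [set a] = ubound (lbound [set a; b] `|` lbound [set a; cpl b]).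

(* a <-> b *)
Definition compatible (d : Order.disp_t) (T : porderType d)
    (cpl : T -> T) (a b : T) : Prop :=
  exists c e f : T,
    [/\ orth cpl c e, orth cpl e f, orth cpl f c,
        is_join c e a & is_join e f b].

(* d(a, b) *)
Definition dset (d : Order.disp_t) (T : porderType d)
    (cpl : T -> T) (a b : T) : set T :=
  ubound (lbound [set a; b] `|` lbound [set a; cpl b] `|`
          lbound [set cpl a; b] `|` lbound [set cpl a; cpl b]).

(* The n-element set N = {1, ..., n} is represented by 'I_n. *)
Definition Pset (n k : nat) : {set {set 'I_n}} :=
  [set X : {set 'I_n} | (k %| #|X|)%N]%SET.

Record Pnk (n k : nat) := MkPnk {
  Pnk_set :> {set 'I_n};
  Pnk_setP : Pnk_set \in Pset n k
}.

HB.instance Definition _ (n k : nat) := [isSub for @Pnk_set n k].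
HB.instance Definition _ (n k : nat) := [Choice of Pnk n k by <:].

Definition Pnk_le (n k : nat) : rel (Pnk n k) :=
  fun X Y => (X : {set 'I_n}) \subset (Y : {set 'I_n}).

Lemma Pnk_le_refl (n k : nat) : reflexive (@Pnk_le n k).
Proof. by move=> X; apply: subxx. Qed.

Lemma Pnk_le_anti (n k : nat) : antisymmetric (@Pnk_le n k).
Proof. by move=> X Y le_XY; apply/val_inj/eqP; rewrite finset.eqEsubset. Qed.

Lemma Pnk_le_trans (n k : nat) : transitive (@Pnk_le n k).
Proof. by move=> Y X Z; apply: fintype.subset_trans. Qed.

HB.instance Definition _ (n k : nat) :=
  Order.Le_isPOrder.Build (Order.Disp tt tt) (Pnk n k)
    (@Pnk_le_refl n k) (@Pnk_le_anti n k) (@Pnk_le_trans n k).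

Lemma Pset0 (n k : nat) : finset.set0 \in Pset n k.
Proof. by rewrite inE cards0. Qed.

Lemma PsetT (n k : nat) (kn : (k %| n)%N) : [set: 'I_n]%SET \in Pset n k.
Proof. by rewrite inE cardsT card_ord. Qed.

Lemma PsetC (n k : nat) (kn : (k %| n)%N) (X : Pnk n k) :
  (~: (X : {set 'I_n}))%SET \in Pset n k.
Proof.
have := Pnk_setP X; rewrite !inE => kX.
by rewrite -(dvdn_addr _ kX) cardsC card_ord.
Qed.

Definition Pempty (n k : nat) : Pnk n k := MkPnk (Pset0 n k).
Definition Pfull (n k : nat) (kn : (k %| n)%N) : Pnk n k := MkPnk (PsetT kn).
Definition Pcpl (n k : nat) (kn : (k %| n)%N) (X : Pnk n k) : Pnk n k :=
  MkPnk (PsetC kn X).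

(* Main.v *)
(* If |A :&: B| >= k, then A :&: B is the union of its k-element subsets, all of
   which lie in L(A, B); if |A :&: B| < k, then L(A, B) = {0}. Hence every cone
   U(L(A, B), ...) is determined by those intersections that have at least k
   elements, and the counterexamples are intervals of {0, ..., n-1} chosen so
   that these intersections are large but have cardinality not divisible by k. *)
Require Import Defs.
From mathcomp Require Import all_boot all_order.
From mathcomp Require Import boolp classical_sets.
From mathcomp Require Import zify.

Set Implicit Arguments.
Unset Strict Implicit.

(** * Subsets of prescribed size through a given point *)

Section FiniteSets.
Implicit Type T : finType.

(** There are ['C(#|Z :\ x|, k.-1) > 0] sets of size [k.-1] inside [Z :\ x]; adding [x] to one of
    them gives [Y]. This is how a large intersection gets covered by its [k]-element subsets. *)
Lemma subset_of_card_mem T (Z : {set T}) (x : T) (k : nat) :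
  x \in Z -> 0 < k <= #|Z| ->
  exists Y : {set T}, [/\ x \in Y, Y \subset Z & #|Y| = k].
Proof.
move=> xZ /andP[k0 kZ].
have kx : k.-1 <= #|Z :\ x| by have := cardsD1 x Z; rewrite xZ; lia.
have : 0 < #|[set Y : {set T} | Y \subset Z :\ x & #|Y| == k.-1]|.
  by rewrite cards_draws bin_gt0.
case/card_gt0P=> Y; rewrite inE => /andP[YZ /eqP cY].
exists (x |: Y); split; first exact: finset.setU11.
- by rewrite finset.subUset finset.sub1set xZ (fintype.subset_trans YZ) ?finset.subD1set.
- have xY : x \notin Y by apply/negP => /(fintype.subsetP YZ); rewrite !inE eqxx.
  by rewrite cardsU1 xY cY; lia.
Qed.

End FiniteSets.

(** * Intervals in ['I_n] and their cardinalities *)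

Section Intervals.
Variable n : nat.

Definition itvI (a b : nat) : {set 'I_n} := [set i : 'I_n | a <= i < b].

Lemma card_itvI (a b : nat) : b <= n -> #|itvI a b| = b - a.
Proof.
move=> bn; rewrite -sum1_card (eq_bigl (fun i : 'I_n => a <= i < b)); last first.
  by move=> i; rewrite inE.
rewrite -(big_mkord (fun i => a <= i < b) (fun=> 1)) big_mkcond /=.
(* The indicator sum over [[0, n)] is cut at [b], then at [a]; the outer pieces vanish. *)
rewrite (@big_cat_nat _ _ _ b) //= [X in _ + X]big_nat_cond
  [X in _ + X]big1 ?addn0; last first.
  by move=> i; rewrite andbT => /andP[bi _]; case: ifP; lia.
case: (leqP a b) => [ab|ba]; last first.
  by rewrite big_nat big1 => [|i]; [lia|case: ifP; lia].
rewrite (@big_cat_nat _ _ _ a) //= [X in X + _]big_nat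
  [X in X + _]big1 ?add0n; last first.
  by move=> i; case: ifP; lia.
rewrite big_nat (eq_bigr (fun=> 1)) => [|i ->//].
by rewrite -big_nat sum_nat_const_nat muln1.
Qed.

End Intervals.

(** * Joins, meets and cones in [Pnk n k] in terms of sets *)

Section Pnk_order.
Variables n k : nat.
Hypotheses (k_gt0 : 0 < k) (kn : k %| n).
Implicit Types X Y Z S : Pnk n k.

Lemma Pnk_leE X Y : (X <= Y)%O = ((X : {set 'I_n}) \subset Y).
Proof. by []. Qed.

Lemma Pnk_dvd X : k %| #|X|.
Proof. by have := Pnk_setP X; rewrite inE. Qed.

Lemma Pnk_card_eq0 X : #|X| < k -> X = finset.set0 :> {set 'I_n}.
Proof.
move=> Xk; apply/eqP; rewrite -cards_eq0; have := Pnk_dvd X.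
by case: #|X| Xk => // m mk /dvdn_leq; lia.
Qed.

Lemma mem_PsetU X Y : X :&: Y = finset.set0 -> X :|: Y \in Pset n k.
Proof. by move=> XY0; rewrite inE cardsU XY0 cards0 subn0 dvdn_add ?Pnk_dvd. Qed.

Lemma mem_PsetD X Y : X :&: Y \in Pset n k -> X :\: Y \in Pset n k.
Proof. by rewrite !inE => XY; rewrite -(dvdn_addr _ XY) cardsID Pnk_dvd. Qed.

Lemma mem_PsetDr X Y : X :&: Y \in Pset n k -> Y :\: X \in Pset n k.
Proof. by rewrite finset.setIC; exact: mem_PsetD. Qed.

Lemma lbound2 X Y Z :
  lbound [set X; Y]%classic Z <-> (Z : {set 'I_n}) \subset X :&: Y.
Proof.
rewrite finset.subsetI; split=> [ZXY|/andP[ZX ZY] _ [->|->]//].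
by apply/andP; split; apply: ZXY; [left|right].
Qed.

Lemma ubound2 X Y Z :
  ubound [set X; Y]%classic Z <-> X :|: Y \subset Z.
Proof.
rewrite finset.subUset; split=> [ZXY|/andP[ZX ZY] _ [->|->]//].
by apply/andP; split; apply: ZXY; [left|right].
Qed.

Lemma is_join_setU X Y S : X :|: Y = S -> is_join X Y S.
Proof.
by move=> US; split=> [|Z]; rewrite /= ?ubound2 US // => /ubound2; rewrite US.
Qed.

Lemma is_meet_setI X Y S : X :&: Y = S -> is_meet X Y S.
Proof.
by move=> US; split=> [|Z]; rewrite /= ?lbound2 US // => /lbound2; rewrite US.
Qed.

(** Disjointness puts the union into [Pset n k], where it competes with [S] as an upper bound.
    Without it a join may be strictly larger than the union. *)
Lemma is_join_disjoint X Y S :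
  X :&: Y = finset.set0 -> is_join X Y S -> S = X :|: Y :> {set 'I_n}.
Proof.
move=> XY0 [/ubound2 XYS Smin].
apply/eqP; rewrite finset.eqEsubset XYS andbT.
by apply: (Smin (MkPnk (mem_PsetU XY0))); apply/ubound2.
Qed.

Lemma orthE X Y : orth (Pcpl kn) X Y <-> X :&: Y = finset.set0.
Proof.
rewrite /orth Pnk_leE /= finset.setIC -finset.disjoints_subset -finset.setI_eq0.
by rewrite finset.setIC; split=> /eqP.
Qed.

Lemma ubound_lbound2 X Y Z :
  ubound (lbound [set X; Y]%classic) Z <->
  (k <= #|X :&: Y| -> X :&: Y \subset Z).
Proof.
split=> [ZU kXY|XYZ W /lbound2 WXY].
  apply/fintype.subsetP => x xXY.
  have kb : 0 < k <= #|X :&: Y| by rewrite k_gt0.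
  have [V [xV VXY cV]] := subset_of_card_mem xXY kb.
  have PV : V \in Pset n k by rewrite inE cV.
  by apply: (fintype.subsetP (ZU (MkPnk PV) _)) => //; apply/lbound2.
(* If the intersection is too small, the lower bound [W] inside it has fewer than [k] elements and
   is empty. *)
rewrite Pnk_leE; case: (leqP k #|X :&: Y|) => [/XYZ|XYk].
  exact: fintype.subset_trans.
by rewrite Pnk_card_eq0 ?finset.sub0set ?(leq_ltn_trans (subset_leq_card WXY)).
Qed.

Lemma uboundU (V W : set (Pnk n k)) Z :
  ubound (V `|` W)%classic Z <-> ubound V Z /\ ubound W Z.
Proof.
split=> [ZU|[ZV ZW] T [/ZV|/ZW]//].
by split=> T TV; apply: ZU; [left|right].
Qed.

Lemma ubound_set1 X Z : ubound [set X]%classic Z <-> (X : {set 'I_n}) \subset Z.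
Proof. by split=> [ZU|XZ _ ->//]; apply: ZU. Qed.

(** Every upper bound of [X] bounds both lower cones, so only the reverse inclusion has content. *)
Lemma DeltaE X Y :
  Delta (Pcpl kn) X Y <->
  forall Z, (k <= #|X :&: Y| -> X :&: Y \subset Z) ->
    (k <= #|X :&: ~: Y| -> X :&: ~: Y \subset Z) ->
    (X : {set 'I_n}) \subset Z.
Proof.
split=> [XY Z XYZ XYCZ|XY].
  apply/ubound_set1; rewrite XY; apply/uboundU.
  by split; apply/ubound_lbound2.
apply/seteqP; split=> Z.
  move/ubound_set1=> XZ; apply/uboundU.
  by split; apply/ubound_lbound2 => _;
    rewrite (fintype.subset_trans _ XZ) ?finset.subsetIl.
by case/uboundU=> /ubound_lbound2 ? /ubound_lbound2 ?; apply/ubound_set1/XY.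
Qed.

Lemma Delta_of_card X Y :
  k <= #|X :&: Y| -> k <= #|X :&: ~: Y| -> Delta (Pcpl kn) X Y.
Proof.
move=> k1 k2; apply/DeltaE => Z /(_ k1) Z1 /(_ k2) Z2.
by rewrite -(finset.setID X Y) finset.setDE finset.subUset Z1.
Qed.

Lemma compatibleE X Y : compatible (Pcpl kn) X Y <-> X :&: Y \in Pset n k.
Proof.
split=> [[c [e [f [/orthE ce /orthE ef /orthE fc]]]]|XY].
  move=> /(is_join_disjoint ce)-> /(is_join_disjoint ef)->.
  rewrite finset.setUC -finset.setUIr finset.setIC fc finset.setU0.
  exact: Pnk_setP.
(* The witnesses are [X] minus [Y], the intersection, and [Y] minus [X]; divisibility of the
   intersection passes to both differences. *)
exists (MkPnk (mem_PsetD XY)), (MkPnk XY), (MkPnk (mem_PsetDr XY)).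
split; [apply/orthE|apply/orthE|apply/orthE|apply: is_join_setU|apply: is_join_setU].
1-5: by apply/setP => i; rewrite /= !inE;
  case: (i \in (X : {set _})); case: (i \in (Y : {set _})).
Qed.

Lemma dset_of_card X Y :
  k <= #|X :&: Y| -> k <= #|X :&: ~: Y| ->
  k <= #|~: X :&: Y| -> k <= #|~: X :&: ~: Y| ->
  dset (Pcpl kn) X Y = [set Pfull kn]%classic.
Proof.
move=> k1 k2 k3 k4; apply/seteqP; split=> Z /=.
  case/uboundU=> /uboundU[/uboundU[U1 U2] U3] U4.
  have /ubound_lbound2/(_ k1)/fintype.subsetP Z1 := U1.
  have /ubound_lbound2/(_ k2)/fintype.subsetP Z2 := U2.
  have /ubound_lbound2/(_ k3)/fintype.subsetP Z3 := U3.
  have /ubound_lbound2/(_ k4)/fintype.subsetP Z4 := U4.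
  apply/val_inj/setP => i; rewrite [RHS]inE.
  (* The four intersections partition ['I_n], so each [i] lies in one of them and hence in [Z]. *)
  move: (Z1 i) (Z2 i) (Z3 i) (Z4 i); rewrite /= !inE.
  by case: (i \in (X : {set _})); case: (i \in (Y : {set _})) => /= z1 z2 z3 z4;
    [exact: z1|exact: z2|exact: z3|exact: z4].
by move=> -> W _; rewrite Pnk_leE finset.subsetT.
Qed.

Lemma Pnk_bounded : is_bounded (Pempty n k) (Pfull kn).
Proof. by move=> X; rewrite !Pnk_leE finset.sub0set finset.subsetT. Qed.

Lemma Pnk_orthomodular_poset :
  is_orthomodular_poset (Pcpl kn) (Pempty n k) (Pfull kn).
Proof.
split; first split; first split.
- exact: Pnk_bounded.
- by move=> X Y; rewrite !Pnk_leE /= finset.setCS.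
- by move=> X; apply: val_inj; rewrite /= finset.setCK.
- by move=> X; apply: is_join_setU; rewrite /= finset.setUCr.
- by move=> X; apply: is_meet_setI; rewrite /= finset.setICr.
- by move=> X Y /orthE XY0; exists (MkPnk (mem_PsetU XY0)); apply: is_join_setU.
move=> X Y XY.
(* Since [X] lies in [Y], it is disjoint from the complement of [Y], so both joins in the
   orthomodular law are plain unions. *)
have XY0 : X :&: Pcpl kn Y = finset.set0.
  by apply/eqP; rewrite /= -finset.setDE finset.setD_eq0.
exists (MkPnk (mem_PsetU XY0)); split; apply: is_join_setU => //=.
rewrite finset.setCU finset.setCK finset.setUIr finset.setUCr finset.setTI.
exact/finset.setUidPr.
Qed.

End Pnk_order.

(** * When [Pnk n k] is a lattice *)

Section Lattice.
Variables n k : nat.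
Hypotheses (k_gt0 : 0 < k) (kn : k %| n).
Implicit Types X Y Z S : Pnk n k.

Lemma is_meet_empty X Y : #|X :&: Y| < k -> is_meet X Y (Pempty n k).
Proof.
move=> XYk; split=> [|Z /lbound2 ZXY]; first by apply/lbound2/finset.sub0set.
by rewrite Pnk_leE Pnk_card_eq0 ?finset.sub0set ?(leq_ltn_trans (subset_leq_card ZXY)).
Qed.

(** De Morgan duality: existence of all meets yields all joins. *)
Lemma is_join_cpl X Y S :
  is_meet (Pcpl kn X) (Pcpl kn Y) S -> is_join X Y (Pcpl kn S).
Proof.
case=> /lbound2 SXY Smax; split=> [|Z /ubound2 XYZ].
  by apply/ubound2; rewrite -finset.setCS /= finset.setCK finset.setCU.
rewrite Pnk_leE -finset.setCS /= finset.setCK.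
by apply: (Smax (Pcpl kn Z)); apply/lbound2; rewrite /= -finset.setCU finset.setCS.
Qed.

Lemma Pnk_lattice : n <= 2 * k -> is_lattice (Pnk n k).
Proof.
move=> n2k.
have meet_ex X Y : exists S, is_meet X Y S.
  have [XYk|kXY] := ltnP #|X :&: Y| k; first by exists (Pempty n k); exact: is_meet_empty.
  (* The intersection now has at least [k] elements. If [X] has at most [k], then [X] lies in [Y];
     otherwise it has at least [2 * k >= n], so it is everything and the meet is [Y]. *)
  have [Xk|kX] := leqP #|X| k.
    exists X; apply: is_meet_setI; apply/eqP.
    by rewrite eqEcard finset.subsetIl (leq_trans Xk).
  exists Y; apply: is_meet_setI; apply/finset.setIidPr.
  suff -> : X = [set: 'I_n] :> {set 'I_n} by exact: finset.subsetT.
  apply/eqP; rewrite eqEcard finset.subsetT cardsT card_ord /=.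
  have /dvdnP[m cX] := Pnk_dvd X; rewrite cX in kX *.
  have m_gt1 : 1 < m by rewrite -(ltn_pmul2r k_gt0) mul1n.
  by apply: leq_trans n2k _; rewrite leq_mul2r m_gt1 orbT.
move=> X Y; split; last exact: meet_ex.
by have [S /is_join_cpl] := meet_ex (Pcpl kn X) (Pcpl kn Y); exists (Pcpl kn S).
Qed.

(** * Counterexamples built from intervals *)

Lemma mem_Pset_itv (m a b : nat) :
  b <= n -> b = a + m * k -> itvI n a b \in Pset n k.
Proof. by move=> bn eb; rewrite inE card_itvI // eb addKn dvdn_mull. Qed.

Lemma leq_card_itv (a b : nat) (Z : {set 'I_n}) :
  b <= n -> (forall i : 'I_n, a <= i < b -> i \in Z) -> b - a <= #|Z|.
Proof.
move=> bn sZ; rewrite -(@card_itvI n a) //; apply/subset_leq_card.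
by apply/fintype.subsetP => i; rewrite inE => /sZ.
Qed.

Lemma not_dvd_card_succ (m : nat) : 1 < k -> ~~ (k %| (m * k).+1).
Proof. by move=> k1; rewrite -addn1 dvdn_addr ?dvdn_mull // dvdn1; lia. Qed.

(** The intervals [[0, 2k)] and [[k-1, 3k-1)] meet in [k + 1] points. Their infimum would have to
    equal this intersection, but [k] does not divide [k + 1]. *)
Lemma Pnk_not_lattice : 1 < k -> 3 * k <= n -> ~ is_lattice (Pnk n k).
Proof.
move=> k_gt1 n3k lat.
have Xn : 2 * k <= n by lia.
have Yn : 3 * k - 1 <= n by lia.
have XP : itvI n 0 (2 * k) \in Pset n k by apply: (@mem_Pset_itv 2); lia.
have YP : itvI n (k - 1) (3 * k - 1) \in Pset n k by apply: (@mem_Pset_itv 2); lia.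
have [_ [S [/lbound2 /= SXY Smax]]] := lat (MkPnk XP) (MkPnk YP).
have XY : itvI n 0 (2 * k) :&: itvI n (k - 1) (3 * k - 1) = itvI n (k - 1) (2 * k).
  by apply/setP => i; rewrite !inE; lia.
have cXY : #|itvI n (k - 1) (2 * k)| = (1 * k).+1 by rewrite card_itvI //; lia.
(* As greatest lower bound, [S] bounds every lower bound from above, hence contains the
   intersection. *)
have XYS : itvI n (k - 1) (2 * k) \subset S.
  have : ubound (lbound [set MkPnk XP; MkPnk YP]%classic) S by move=> Z /Smax.
  by move=> /(ubound_lbound2 k_gt0) /=; rewrite XY cXY; apply; lia.
have eS : itvI n (k - 1) (2 * k) = S.
  by apply/eqP; rewrite finset.eqEsubset XYS -XY.
by have := not_dvd_card_succ 1 k_gt1; rewrite -cXY eS Pnk_dvd.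
Qed.

(** For [X = [1, 3k+1)] and [Y = [0, 2k)], the set [X] splits along [Y] into pieces of sizes
    [2k - 1] and [k + 1], both large. Along [X], however, [Y] leaves only the point 0 outside, which
    is too small to be seen. *)
Lemma Delta_asym : 1 < k -> 4 * k <= n ->
  exists X Y : Pnk n k, Delta (Pcpl kn) X Y /\ ~ Delta (Pcpl kn) Y X.
Proof.
move=> k_gt1 n4k.
have XP : itvI n 1 (3 * k + 1) \in Pset n k by apply: (@mem_Pset_itv 3); lia.
have YP : itvI n 0 (2 * k) \in Pset n k by apply: (@mem_Pset_itv 2); lia.
exists (MkPnk XP), (MkPnk YP); split.
  apply: Delta_of_card => //=.
    apply: (@leq_trans (2 * k - 1)); first by lia.
    by apply: leq_card_itv => [|i]; rewrite ?inE; lia.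
  apply: (@leq_trans (3 * k + 1 - 2 * k)); first by lia.
  by apply: leq_card_itv => [|i]; rewrite ?inE; lia.
(* The test set is [X] itself: it contains [Y :&: X] but misses the point 0 of [Y]. *)
move=> /(DeltaE k_gt0)/(_ (MkPnk XP)) /= YX.
have n0 : 0 < n by lia.
suff : Ordinal n0 \in itvI n 1 (3 * k + 1) by rewrite inE.
apply: (fintype.subsetP (YX _ _)) => [_|k_le|].
- exact: finset.subsetIr.
- suff : #|itvI n 0 (2 * k) :&: ~: itvI n 1 (3 * k + 1)| <= 1.
    by move/(leq_trans k_le); rewrite leqNgt k_gt1.
  rewrite -[X in _ <= X](subn0 1) -(@card_itvI n 0) //.
  by apply/subset_leq_card/fintype.subsetP => i; rewrite !inE; lia.
- by rewrite inE /=; lia.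
Qed.

(** For [X = [0, 3k)] and [Y = [2k-1, 5k-1)], the four pieces have sizes [k + 1], [2k - 1], [2k - 1]
    and [n - 5k + 1], all at least [k], while [k] does not divide the first. *)
Lemma dset_full_not_compatible : 1 < k -> 6 * k <= n ->
  exists X Y : Pnk n k,
    ~ compatible (Pcpl kn) X Y /\ dset (Pcpl kn) X Y = [set Pfull kn]%classic.
Proof.
move=> k_gt1 n6k.
have XP : itvI n 0 (3 * k) \in Pset n k by apply: (@mem_Pset_itv 3); lia.
have YP : itvI n (2 * k - 1) (5 * k - 1) \in Pset n k.
  by apply: (@mem_Pset_itv 3); lia.
exists (MkPnk XP), (MkPnk YP); split.
  move/compatibleE => /=; rewrite inE; apply/negP.
  have -> : itvI n 0 (3 * k) :&: itvI n (2 * k - 1) (5 * k - 1) =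
            itvI n (2 * k - 1) (3 * k) by apply/setP => i; rewrite !inE; lia.
  have -> : #|itvI n (2 * k - 1) (3 * k)| = (1 * k).+1 by rewrite card_itvI; lia.
  exact: not_dvd_card_succ.
apply: dset_of_card => //=.
- apply: (@leq_trans (3 * k - (2 * k - 1))); first by lia.
  by apply: leq_card_itv => [|i]; rewrite ?inE; lia.
- apply: (@leq_trans (2 * k - 1 - 0)); first by lia.
  by apply: leq_card_itv => [|i]; rewrite ?inE; lia.
- apply: (@leq_trans (5 * k - 1 - 3 * k)); first by lia.
  by apply: leq_card_itv => [|i]; rewrite ?inE; lia.
- apply: (@leq_trans (n - (5 * k - 1))); first by lia.
  by apply: leq_card_itv => [|i]; rewrite ?inE; lia.
Qed.

(* If 0 < |X :&: Y| < k, then both L(X, Y) and L(X, Y') reduce to {0}. *)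
Lemma Delta_atom X Y :
  #|X| = k -> Delta (Pcpl kn) X Y <-> compatible (Pcpl kn) X Y.
Proof.
move=> Xk; rewrite DeltaE // compatibleE inE.
have cXY : #|X :&: Y| + #|X :&: ~: Y| = k by rewrite -finset.setDE cardsID.
split=> [XY|/dvdnP[m cm] Z XYZ XYCZ].
  have [->|XY0] := eqVneq #|X :&: Y| 0; first exact: dvdn0.
  have [kXY|XYk] := leqP k #|X :&: Y|.
    by have -> : #|X :&: Y| = k by lia.
  suff : (X : {set 'I_n}) \subset finset.set0.
    by move/subset_leq_card; rewrite cards0; lia.
  have XYCk : #|X :&: ~: Y| < k by lia.
  by apply: (XY (Pempty n k)); rewrite leqNgt ?XYk ?XYCk.
(* A multiple of [k] that is at most [k] is 0 or [k], so [X] lies in [Y] or in its complement, and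
   one premise on [Z] already gives the claim. *)
case: m cm => [|m] cm; last first.
  have kXY : k <= #|X :&: Y| by nia.
  suff <- : X :&: Y = X by exact: XYZ.
  by apply/eqP; rewrite eqEcard finset.subsetIl Xk.
have kXY : k <= #|X :&: ~: Y| by lia.
suff <- : X :&: ~: Y = X by exact: XYCZ.
by apply/eqP; rewrite eqEcard finset.subsetIl Xk.
Qed.

End Lattice.

(** For [k = 1] divisibility is void and the poset is the full power set. *)
Lemma Pn1_boolean_algebra (n : nat) (n1 : 1 %| n) :
  is_boolean_algebra (Pcpl n1) (Pempty n 1) (Pfull n1).
Proof.
have P1 (Z : {set 'I_n}) : Z \in Pset n 1 by rewrite inE dvd1n.
split; first exact: Pnk_bounded.
exists (fun X Y : Pnk n 1 => MkPnk (P1 (X :|: Y))),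
       (fun X Y : Pnk n 1 => MkPnk (P1 (X :&: Y))).
split=> [X Y|X Y|X Y Z|X|X].
- exact: is_join_setU.
- exact: is_meet_setI.
- by apply: val_inj; rewrite /= finset.setIUl.
- by apply: val_inj; rewrite /= finset.setUCr.
- by apply: val_inj; rewrite /= finset.setICr.
Qed.

Unset Implicit Arguments.

Theorem theorem5p2 (n k : nat) (n_gt0 : 0 < n) (k_gt0 : 0 < k) (kn : k %| n)
    (A B C : Pnk n k) :
  (* (i) *)
  is_orthomodular_poset (Pcpl kn) (Pempty n k) (Pfull kn) /\
  (* (ii) *)
  (orth (Pcpl kn) A B <-> A :&: B = finset.set0) /\
  (* (iii) *)
  (compatible (Pcpl kn) A B <-> A :&: B \in Pset n k) /\
  (* (iv) *)
  ((is_orthomodular_lattice (Pcpl kn) (Pempty n k) (Pfull kn) <->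
      k = 1 \/ n %/ k <= 2) /\
   (k = 1 -> is_boolean_algebra (Pcpl kn) (Pempty n k) (Pfull kn))) /\
  (* (v) *)
  (#|A :&: B| < k -> ubound (lbound [set A; B]%classic) = [set: Pnk n k]%classic) /\
  (* (vi) *)
  (k <= #|A :&: B| ->
     (ubound (lbound [set A; B]%classic) C <-> A :&: B \subset C)) /\
  (* (vii) *)
  (k <= #|A :&: B| -> k <= #|A :&: Pcpl kn B| -> Delta (Pcpl kn) A B) /\
  (* (viii) *)
  (k <= #|A :&: B| -> k <= #|A :&: Pcpl kn B| ->
   k <= #|Pcpl kn A :&: B| -> k <= #|Pcpl kn A :&: Pcpl kn B| ->
     dset (Pcpl kn) A B = [set Pfull kn]%classic) /\
  (* (ix) *)
  (4 * k <= n -> 1 < k ->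
     exists D E : Pnk n k, Delta (Pcpl kn) D E /\ ~ Delta (Pcpl kn) E D) /\
  (* (x) *)
  (6 * k <= n -> 1 < k ->
     exists D E : Pnk n k,
       ~ compatible (Pcpl kn) D E /\ dset (Pcpl kn) D E = [set Pfull kn]%classic) /\
  (* (xi) *)
  (#|A| = k -> (Delta (Pcpl kn) A B <-> compatible (Pcpl kn) A B)).
Proof.
split; first exact: Pnk_orthomodular_poset.
split; first exact: orthE.
split; first exact: compatibleE.
split; first split.
- split=> [[_ lat]|nk]; last split.
  + have [k_gt1|k_le1] := ltnP 1 k; [right|by left; lia].
    rewrite leqNgt; apply/negP => nk; apply: Pnk_not_lattice lat => //.
    by rewrite -leq_divRL.
  + exact: Pnk_orthomodular_poset.
  + case: nk => [k1|nk]; last first.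
      by apply: (Pnk_lattice k_gt0 kn); rewrite -(divnK kn) leq_mul2r nk orbT.
    subst k; have [_ [join [meet [joinP meetP _ _ _]]]] := Pn1_boolean_algebra kn.
    by move=> X Y; split; [exists (join X Y)|exists (meet X Y)].
- by move=> k1; subst k; exact: Pn1_boolean_algebra.
split=> [ABk|].
  (* The size premise in the description of the cone is false here, so every [Z] qualifies. *)
  by rewrite -classical_sets.subTset => Z _; apply/(ubound_lbound2 k_gt0); lia.
split=> [kAB|].
  by rewrite ubound_lbound2 //; split=> [/(_ kAB)|].
split; first exact: Delta_of_card.
split; first exact: dset_of_card.
split=> [n4k k_gt1|]; first exact: Delta_asym.
split=> [n6k k_gt1|]; first exact: dset_full_not_compatible.
exact: Delta_atom.
Qed.
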